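(* Let $\Gamma$ and $\Sigma$ be two graphs and let $p$ be a mapping from $V(\Gamma)\times V(\Gamma)$ to $\mathrm{Aut}(\Sigma)$ such that $p(a,b)=p(b,a)^{-1}$ for all $(a,b)\in V(\Gamma)\times V(\Gamma)$. Then the direct product bundle $\Gamma\times^{p}\Sigma$ is unstable if one of the following holds: (i) $\Gamma$ has a TF-morphism $(\alpha,\beta)$ with $\alpha\neq\beta$ such that $p(a^{\alpha},b^{\beta})=p(a,b)$ for every $(a,b)\in V(\Gamma)\times V(\Gamma)$; (ii) there are a TF-morphism $(\alpha,\beta)$ of $\Sigma$ and a permutation $\theta$ of $V(\Sigma)$ such that $\alpha\neq\theta$ and $\theta\, p(a,b)^{-1}=p(a,b)^{-1}\beta$ for every $(a,b)\in V(\Gamma)\times V(\Gamma)$.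
   Context: All graphs are finite, undirected and simple. For a permutation $\alpha$ and point $x$, $x^\alpha$ denotes the image of $x$, and permutations are composed left to right: $x^{\alpha\beta}=(x^\alpha)^\beta$. A TF-morphism of a graph $\Gamma$ is an ordered pair $(\alpha,\beta)$ of permutations of $V(\Gamma)$ such that $u\sim_\Gamma v$ implies $u^\alpha\sim_\Gamma v^\beta$. The direct product bundle $\Gamma\times^{p}\Sigma$ is the graph with vertex set $V(\Gamma)\times V(\Sigma)$ where $(a,x)\sim(b,y)$ iff $a\sim_\Gamma b$ and $x\sim_\Sigma y^{p(a,b)^{-1}}$. A graph $\Lambda$ is stable if $\mathrm{Aut}(\Lambda\times K_2)=\mathrm{Aut}(\Lambda)\times\mathrm{Aut}(K_2)$, where $\Lambda\times K_2$ is the direct product (vertex set $V(\Lambda)\times V(K_2)$, $(a,x)\sim(b,y)$ iff $a\sim b$ and $x\sim y$) and $\mathrm{Aut}(\Lambda)\times\mathrm{Aut}(K_2)$ acts coordinatewise; otherwise $\Lambda$ is unstable. *)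

(* Defs.v *)
From HB Require Import structures.
From mathcomp Require Import all_boot all_fingroup.

Set Implicit Arguments.
Unset Strict Implicit.
Unset Printing Implicit Defensive.

Import GroupScope.

Record sgraph := SGraph {
  vertex :> finType;
  adj : rel vertex;
  adj_sym : symmetric adj;
  adj_irr : irreflexive adj
}.

Section Automorphisms.
Variable G : sgraph.

Definition gaut : {set {perm G}} :=
  [set s : {perm G} | [forall u, forall v, adj (s u) (s v) == adj u v]].

Lemma gautP (s : {perm G}) :
  reflect (forall u v, adj (s u) (s v) = adj u v) (s \in gaut).
Proof.
rewrite inE; apply: (iffP forallP) => [h u v | h u].
  by have /forallP/(_ v)/eqP := h u.
by apply/forallP => v; rewrite h.
Qed.

Lemma gaut_group_set : group_set gaut.
Proof.
apply/group_setP; split=> [|s t /gautP hs /gautP ht]; apply/gautP => u v.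
  by rewrite !perm1.
by rewrite !permM ht hs.
Qed.

Canonical gaut_group := Group gaut_group_set.

Definition TF_morphism (alpha beta : {perm G}) : Prop :=
  forall u v : G, adj u v -> adj (alpha u) (beta v).

End Automorphisms.

Definition K2_adj : rel bool := fun x y => x != y.

Lemma K2_adj_sym : symmetric K2_adj.
Proof. by move=> x y; rewrite /K2_adj eq_sym. Qed.

Lemma K2_adj_irr : irreflexive K2_adj.
Proof. by move=> x; rewrite /K2_adj eqxx. Qed.

Definition K2 : sgraph := SGraph K2_adj_sym K2_adj_irr.

Section DirectProduct.
Variables G H : sgraph.

Definition dprod_adj : rel (G * H)%type :=
  fun u v => adj u.1 v.1 && adj u.2 v.2.

Lemma dprod_adj_sym : symmetric dprod_adj.
Proof. by move=> u v; rewrite /dprod_adj adj_sym [X in _ && X]adj_sym. Qed.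

Lemma dprod_adj_irr : irreflexive dprod_adj.
Proof. by move=> u; rewrite /dprod_adj adj_irr. Qed.

Definition dprod_graph : sgraph := SGraph dprod_adj_sym dprod_adj_irr.

End DirectProduct.

Section Bundle.
Variables (G S : sgraph) (p : G -> G -> {perm S}).
Hypothesis p_aut : forall a b : G, p a b \in gaut S.
Hypothesis p_inv : forall a b : G, p a b = (p b a)^-1.

Definition bundle_adj : rel (G * S)%type :=
  fun u v => adj u.1 v.1 && adj u.2 ((p u.1 v.1)^-1 v.2).

Lemma bundle_adj_sym : symmetric bundle_adj.
Proof.
move=> [a x] [b y]; rewrite /bundle_adj /= adj_sym; congr (_ && _).
have /gautP h := p_aut a b.
by rewrite -h permKV -p_inv adj_sym.
Qed.

Lemma bundle_adj_irr : irreflexive bundle_adj.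
Proof. by move=> u; rewrite /bundle_adj adj_irr. Qed.

Definition bundle : sgraph := SGraph bundle_adj_sym bundle_adj_irr.

End Bundle.

Definition coord_fun (A B : finType) (st : {perm A} * {perm B}) (u : A * B) :
  A * B := (st.1 u.1, st.2 u.2).

Lemma coord_fun_inj (A B : finType) (st : {perm A} * {perm B}) :
  injective (coord_fun st).
Proof. by move=> [a b] [c d] [/perm_inj -> /perm_inj ->]. Qed.

Definition coord_perm (A B : finType) (st : {perm A} * {perm B}) :
  {perm A * B} := perm (@coord_fun_inj A B st).

(* The equality Aut(L x K2) = Aut(L) x Aut(K2) identifies a pair with its
   coordinatewise action, so it says that [coord_perm] is an isomorphism from
   the external direct product onto Aut(L x K2).  Injectivity is automatic when
   L has a vertex; the graph with no vertices is unstable, because there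
   Aut(L) x Aut(K2) has order 2 while Aut(L x K2) is trivial. *)
Definition stable (L : sgraph) : bool :=
  misom (setX (gaut L) (gaut K2)) (gaut (dprod_graph L K2))
        (@coord_perm L K2).

Lemma coord_perm_morphic (A B : finType) (D : {set {perm A} * {perm B}}) :
  morphic D (@coord_perm A B).
Proof.
apply/morphicP => s t _ _; apply/permP => u.
by rewrite permM !permE /coord_fun /= !permM.
Qed.

Lemma stableE (L : sgraph) : 0 < #|L| ->
  stable L =
  (@coord_perm L K2 @: setX (gaut L) (gaut K2) == gaut (dprod_graph L K2)).
Proof.
move=> /card_gt0P[a0 _].
have inj : injective (@coord_perm L K2).
  move=> [s1 s2] [t1 t2] /permP e; congr (_, _); apply/permP => x.
    by move: (e (x, true)); rewrite !permE => -[].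
  by move: (e (a0, x)); rewrite !permE => -[].
have f1 : @coord_perm L K2 1 = 1.
  by apply/permP => -[x y]; rewrite !permE /coord_fun /= !perm1.
rewrite /stable /misom coord_perm_morphic /= /isom.
have X1 : 1 \in setX (gaut L) (gaut K2) by exact: group1.
have Y1 : 1 \in gaut (dprod_graph L K2) by exact: group1.
move: X1 Y1; set X := setX _ _; set Y := gaut _ => X1 Y1.
rewrite -{2}(setD1K X1) imsetU1 f1 -{2}(setD1K Y1).
apply/eqP/eqP => [-> //|e].
have nX : 1 \notin @coord_perm L K2 @: X^#.
  apply/imsetP => -[z zX]; rewrite -f1 => /inj z1.
  by rewrite -z1 setD11 in zX.
by rewrite -(setU1K nX) e setU1K ?setD11.
Qed.

Definition unstable (L : sgraph) : bool := ~~ stable L.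

(* Main.v *)
(* A TF-morphism (A, B) of a graph L with A <> B gives the automorphism of
   L x K2 that acts as A on one colour class and as B on the other; it does not
   act coordinatewise, so L is unstable.  Under (i) such a pair on the bundle is
   (a, x) |-> (alpha a, x), (a, x) |-> (beta a, x), and under (ii) it is
   (a, x) |-> (a, alpha x), (a, x) |-> (a, theta x).  The two maps may coincide
   only if the bundle has no vertex. *)

Require Import Defs.
From HB Require Import structures.
From mathcomp Require Import all_boot all_fingroup.

Set Implicit Arguments.
Unset Strict Implicit.
Unset Printing Implicit Defensive.

Import GroupScope.

(* By finiteness: (u, v) |-> (alpha u, beta v) is injective and maps the finite
   set of arcs into itself, hence onto itself. *)
Lemma TF_morphism_adj (L : sgraph) (alpha beta : {perm L}) :
  TF_morphism alpha beta -> forall u v, adj (alpha u) (beta v) = adj u v.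
Proof.
move=> tf u v; apply/idP/idP=> [auv|]; last exact: tf.
pose E := [set w : L * L | adj w.1 w.2].
have sub : coord_perm (alpha, beta) @: E \subset E.
  apply/subsetP => _ /imsetP[w + ->].
  by rewrite !inE permE /=; exact: tf.
have imE : coord_perm (alpha, beta) @: E = E.
  by apply/eqP; rewrite eqEcard sub (card_imset _ perm_inj) leqnn.
have : (alpha u, beta v) \in coord_perm (alpha, beta) @: E by rewrite imE inE.
case/imsetP=> -[u' v']; rewrite inE permE /= => auv' [].
by move=> /perm_inj -> /perm_inj ->.
Qed.

Lemma unstable_card0 (L : sgraph) : #|L| = 0%N -> unstable L.
Proof.
move=> L0; apply/negP => /andP[_ /eqP e].
have swapK2 : tperm false true \in gaut K2.
  by apply/gautP => x y; rewrite /= /K2_adj (inj_eq perm_inj).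
have swapX : (1, tperm false true) \in (setX (gaut L) (gaut K2))^#.
  rewrite in_setD1 in_setX group1 swapK2 !andbT.
  by apply/eqP => -[/permP/(_ true)]; rewrite tpermR perm1.
(* With no vertices this nontrivial pair acts as the identity, yet an isomorphism sends nontrivial
   pairs to nontrivial permutations. *)
have := imset_f (@coord_perm L K2) swapX; rewrite e in_setD1 => /andP[/eqP[]].
by apply/permP => -[u x]; have := card0_eq L0 u; rewrite inE.
Qed.

Section BicolouredPerm.
Variables (T : finType) (A B : {perm T}).

Definition bicol_fun (u : T * bool) : T * bool :=
  ((if u.2 then B else A) u.1, u.2).

Lemma bicol_fun_inj : injective bicol_fun.
Proof.
by move=> [u x] [v y] [/[swap]] -> ; case: y => /= /perm_inj ->.
Qed.

Definition bicol_perm : {perm T * bool} := perm bicol_fun_inj.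

End BicolouredPerm.

(** Colours are kept and edges join different colours, so one end of an edge moves by [A] and the
    other by [B]. *)
Lemma bicol_perm_gaut (L : sgraph) (A B : {perm L}) :
  TF_morphism A B -> bicol_perm A B \in gaut (dprod_graph L K2).
Proof.
move=> /TF_morphism_adj tf; apply/gautP => -[u x] [v y].
rewrite !permE /bicol_fun /= /dprod_adj /= /K2_adj.
case: x y => -[]; rewrite ?andbF ?andbT //=.
by rewrite adj_sym tf adj_sym.
Qed.

(** A coordinatewise permutation moves the first coordinate of [(u, false)] and [(u, true)] alike,
    which would force [A u = B u]. *)
Lemma TF_morphism_unstable (L : sgraph) (A B : {perm L}) (u : L) :
  TF_morphism A B -> A u <> B u -> unstable L.
Proof.
move=> tf neqAB; have L_gt0 : 0 < #|L| by apply/card_gt0P; exists u.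
rewrite /unstable stableE //; apply/eqP => e.
have := bicol_perm_gaut tf; rewrite -e => /imsetP[st _ /permP eAB].
move: (eAB (u, false)) (eAB (u, true)).
rewrite !permE /bicol_fun /coord_fun /= => -[Au _] [Bu _].
by apply: neqAB; rewrite Au Bu.
Qed.

Lemma perm_neq_ex (T : finType) (s t : {perm T}) :
  s <> t -> exists x, s x <> t x.
Proof.
move=> neq_st; have /existsP[x /eqP neqx] : [exists x, s x != t x].
  apply: contra_notT neq_st => /existsPn eq_st.
  by apply/permP => x; apply/eqP; rewrite -[_ == _]negbK.
by exists x.
Qed.

Theorem theorem1p2 (G S : sgraph) (p : G -> G -> {perm S})
    (p_aut : forall a b : G, p a b \in gaut S)
    (p_inv : forall a b : G, p a b = (p b a)^-1) :
  (exists alpha beta : {perm G},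
     [/\ TF_morphism alpha beta,
         alpha <> beta
       & forall a b : G, p (alpha a) (beta b) = p a b])
  \/
  (exists alpha beta theta : {perm S},
     [/\ TF_morphism alpha beta,
         alpha <> theta
       & forall a b : G, theta * (p a b)^-1 = (p a b)^-1 * beta]) ->
  unstable (bundle p_aut p_inv).
Proof.
have [/eqP B0 _|] := posnP #|bundle p_aut p_inv|.
  by apply: unstable_card0; apply/eqP.
(* The two maps must differ at a vertex of the bundle: [x0] completes it in the first case, [a0] in
   the second. *)
case/card_gt0P=> -[a0 x0] _ [].
  case=> alpha [beta [tf /perm_neq_ex[a neq_a] p_tf]].
  apply: (@TF_morphism_unstable (bundle p_aut p_inv)
            (coord_perm (alpha, 1)) (coord_perm (beta, 1)) (a, x0)); last first.
    by rewrite !permE /coord_fun /= => -[].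
  move=> [b x] [c y]; rewrite !permE /= /bundle_adj /= !perm1 p_tf.
  by case/andP=> /tf ->.
case=> alpha [beta [theta [tf /perm_neq_ex[x neq_x] p_tf]]].
apply: (@TF_morphism_unstable (bundle p_aut p_inv)
          (coord_perm (1, alpha)) (coord_perm (1, theta)) (a0, x)); last first.
  by rewrite !permE /coord_fun /= => -[].
move=> [b y] [c z]; rewrite !permE /= /bundle_adj /= !perm1.
(* Moving [theta] past the twist turns it into [beta], so [tf] applies to [y] and the twisted
   [z]. *)
by rewrite -(permM theta) p_tf permM => /andP[-> /tf].
Qed.
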